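(* Let $(R,\mathfrak m)$ be a commutative Noetherian local ring with positive depth and let $x\in\mathfrak m$ be a non-zerodivisor on $R$. If $R$ satisfies (SACC), then $R/xR$ satisfies (SAC).
   Context: All rings are commutative Noetherian with identity. A ring $R$ satisfies (SAC) if for each finitely generated $R$-module $M$: whenever $\mathrm{Ext}_R^i(M,R)=0$ for all $i>0$ and $\mathrm{Ext}_R^i(M,M)=0$ for all sufficiently large $i$, one has $\mathrm{Ext}_R^i(M,M)=0$ for all $i>0$. A ring $R$ satisfies (SACC) if the same implication holds for each finitely generated $R$-module $M$ that has constant rank. A finitely generated $R$-module $M$ has constant rank $r$ if $M\otimes_R Q$ is a free $Q$-module of rank $r$, where $Q$ is the total ring of fractions of $R$. *)

(* Defs.v *)
From HB Require Import structures.
From mathcomp Require Import all_boot all_order all_algebra.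
From mathcomp Require Import ring boolp classical_sets.

Set Implicit Arguments.
Unset Strict Implicit.
Unset Printing Implicit Defensive.

Import GRing.Theory.
Local Open Scope ring_scope.
Local Open Scope quotient_scope.

Section Ideals.
Variable R : comNzRingType.

Definition span_of (M : lmodType R) (s : seq M) : set M :=
  [set v | exists c : nat -> R, v = \sum_(i < size s) c i *: s`_i].

Definition finitely_generated (M : lmodType R) : Prop :=
  exists s : seq M, forall v : M, span_of s v.

(* Not the library's [idealr_closed], which forces the ideal to be proper. *)
Definition ideal (I : set R) : Prop :=
  [/\ I 0, forall a b, I a -> I b -> I (a + b) & forall a b, I b -> I (a * b)].

(* [R^o] is [R] as a module over itself, so [span_of] is here the ideal
   generated by a sequence. *)
Definition ideal_span (s : seq R) : set R := @span_of R^o s.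

Definition noetherian : Prop :=
  forall I : set R, ideal I -> exists s : seq R, I = ideal_span s.

Definition maximal_ideal (m : set R) : Prop :=
  [/\ ideal m, ~ m 1 &
      forall J : set R, ideal J -> (m `<=` J)%classic -> ~ J 1 -> J = m].

Definition local_ring (m : set R) : Prop :=
  maximal_ideal m /\ forall n : set R, maximal_ideal n -> n = m.

(* The second clause says that [s`_i] is a nonzerodivisor on
   [R / (s`_0, ..., s`_(i-1))]. *)
Definition regular_sequence (s : seq R) : Prop :=
  ~ ideal_span s 1 /\
  forall i, (i < size s)%N -> forall a : R,
    ideal_span (take i s) (s`_i * a) -> ideal_span (take i s) a.

(* The depth of a Noetherian local ring [(R, m)] is the supremum of the
   lengths of the regular sequences in [m]. *)
Definition depth_ge (m : set R) (n : nat) : Prop :=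
  exists s : seq R,
    [/\ size s = n, forall a, a \in s -> m a & regular_sequence s].

Definition positive_depth (m : set R) : Prop := depth_ge m 1.

End Ideals.

Section PrincipalQuotient.
Variables (R : comNzRingType) (x : R).

Definition nonunit : Prop := ~ exists y, y * x = 1.

(* The properness argument is kept because [idealr], hence [{ideal_quot _}],
   requires a proper ideal. *)
Definition principal_ideal (_ : nonunit) : {pred R} :=
  [pred a | `[< exists b, a = b * x >]].

Variable xN : nonunit.

Lemma principal_idealr_closed : idealr_closed (principal_ideal xN).
Proof.
split.
- by apply/asboolP; exists 0; rewrite mul0r.
- by apply/negP => /asboolP[b eb]; apply: xN; exists b.
- move=> a u v /asboolP[b ->] /asboolP[c ->].
  by apply/asboolP; exists (a * b + c); rewrite mulrDl mulrA.
Qed.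

HB.instance Definition _ :=
  isIdealr.Build R (principal_ideal xN) principal_idealr_closed.

Definition quotient_by : comNzRingType :=
  {ideal_quot (Idealr.clone R (principal_ideal xN) _)}.

End PrincipalQuotient.

Lemma local_nonunit (R : comNzRingType) (m : set R) (x : R) :
  local_ring m -> m x -> nonunit x.
Proof. by case=> -[[_ _ mM] m1 _] _ mx [y yx1]; apply: m1; rewrite -yx1; apply: mM. Qed.

Section TotalFractionsDef.
Variable R : comNzRingType.

Record ratio := MkRatio { frac :> R * R; _ : `[< GRing.lreg frac.2 >] }.

HB.instance Definition _ := [isSub for frac].
HB.instance Definition _ := [Choice of ratio by <:].

Lemma den_reg (u : ratio) : GRing.lreg u.2.
Proof. by case: u => u /= /asboolP. Qed.

Definition ratio_of (a b : R) (bP : GRing.lreg b) : ratio :=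
  @MkRatio (a, b) (asboolT bP).

Definition ratio_eq (u v : ratio) : bool := u.1 * v.2 == v.1 * u.2.

Lemma ratio_eq_refl : reflexive ratio_eq.
Proof. by move=> u; exact: eqxx. Qed.

Lemma ratio_eq_sym : symmetric ratio_eq.
Proof. by move=> u v; rewrite /ratio_eq eq_sym. Qed.

Lemma ratio_eq_trans : transitive ratio_eq.
Proof.
move=> v u w /eqP uv /eqP vw; apply/eqP; apply: (den_reg (u := v)).
rewrite (_ : _ * _ = u.1 * v.2 * w.2); last by ring.
rewrite uv (_ : _ * _ = v.1 * w.2 * u.2); last by ring.
by rewrite vw; ring.
Qed.

Canonical ratio_equiv :=
  EquivRel ratio_eq ratio_eq_refl ratio_eq_sym ratio_eq_trans.

Definition total_fractions := {eq_quot ratio_eq}.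

HB.instance Definition _ := EqQuotient.on total_fractions.
HB.instance Definition _ := Choice.on total_fractions.

End TotalFractionsDef.

Section TotalFractionsRing.
Variable R : comNzRingType.

Local Notation Q := (total_fractions R).
Implicit Types (u v w : ratio R) (a b c : Q).

Lemma ratio_eqP u v : \pi_Q u = \pi_Q v <-> u.1 * v.2 = v.1 * u.2.
Proof.
split=> [/eqmodP /eqP //|uv]; apply/eqmodP; exact/eqP.
Qed.

Lemma ratio_repr u : u.1 * (repr (\pi_Q u)).2 = (repr (\pi_Q u)).1 * u.2.
Proof. by apply/ratio_eqP; rewrite reprK. Qed.

Definition ratio_add u v : ratio R :=
  ratio_of (u.1 * v.2 + v.1 * u.2) (lregM (den_reg (u := u)) (den_reg (u := v))).
Definition ratio_opp u : ratio R := ratio_of (- u.1) (den_reg (u := u)).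
Definition ratio_mul u v : ratio R :=
  ratio_of (u.1 * v.1) (lregM (den_reg (u := u)) (den_reg (u := v))).
Definition ratio_embed (x : R) : ratio R := ratio_of x (@lreg1 R).

Definition tf_add a b : Q := \pi_Q (ratio_add (repr a) (repr b)).
Definition tf_opp a : Q := \pi_Q (ratio_opp (repr a)).
Definition tf_mul a b : Q := \pi_Q (ratio_mul (repr a) (repr b)).
Definition tofrac (x : R) : Q := \pi_Q (ratio_embed x).

Lemma pi_tf_add u v : tf_add (\pi_Q u) (\pi_Q v) = \pi_Q (ratio_add u v).
Proof.
apply/ratio_eqP => /=; have := ratio_repr u; have := ratio_repr v.
set u' := repr (\pi_Q u); set v' := repr (\pi_Q v) => ev eu.
transitivity (u'.1 * u.2 * v'.2 * v.2 + v'.1 * v.2 * u'.2 * u.2); first by ring.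
by rewrite -ev -eu; ring.
Qed.

Lemma pi_tf_opp u : tf_opp (\pi_Q u) = \pi_Q (ratio_opp u).
Proof. by apply/ratio_eqP => /=; rewrite !mulNr ratio_repr. Qed.

Lemma pi_tf_mul u v : tf_mul (\pi_Q u) (\pi_Q v) = \pi_Q (ratio_mul u v).
Proof.
apply/ratio_eqP => /=; have := ratio_repr u; have := ratio_repr v.
set u' := repr (\pi_Q u); set v' := repr (\pi_Q v) => ev eu.
transitivity (u'.1 * u.2 * (v'.1 * v.2)); first by ring.
by rewrite -ev -eu; ring.
Qed.

Lemma tf_addA : associative tf_add.
Proof.
elim/quotW=> u; elim/quotW=> v; elim/quotW=> w.
rewrite (pi_tf_add v w) (pi_tf_add u v) 2!pi_tf_add.
by apply/ratio_eqP => /=; ring.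
Qed.

Lemma tf_addC : commutative tf_add.
Proof.
elim/quotW=> u; elim/quotW=> v; rewrite !pi_tf_add.
by apply/ratio_eqP => /=; ring.
Qed.

Lemma tf_add0 : left_id (tofrac 0) tf_add.
Proof.
elim/quotW=> u; rewrite pi_tf_add.
by apply/ratio_eqP => /=; ring.
Qed.

Lemma tf_addN : left_inverse (tofrac 0) tf_opp tf_add.
Proof.
elim/quotW=> u; rewrite (pi_tf_opp u) pi_tf_add.
by apply/ratio_eqP => /=; ring.
Qed.

HB.instance Definition _ :=
  GRing.isZmodule.Build Q tf_addA tf_addC tf_add0 tf_addN.

Lemma tf_mulA : associative tf_mul.
Proof.
elim/quotW=> u; elim/quotW=> v; elim/quotW=> w.
rewrite (pi_tf_mul v w) (pi_tf_mul u v) 2!pi_tf_mul.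
by apply/ratio_eqP => /=; ring.
Qed.

Lemma tf_mulC : commutative tf_mul.
Proof.
elim/quotW=> u; elim/quotW=> v; rewrite !pi_tf_mul.
by apply/ratio_eqP => /=; ring.
Qed.

Lemma tf_mul1 : left_id (tofrac 1) tf_mul.
Proof.
elim/quotW=> u; rewrite pi_tf_mul.
by apply/ratio_eqP => /=; ring.
Qed.

Lemma tf_mulDl : left_distributive tf_mul tf_add.
Proof.
elim/quotW=> u; elim/quotW=> v; elim/quotW=> w.
rewrite (pi_tf_add u v) (pi_tf_mul u w) (pi_tf_mul v w) pi_tf_mul pi_tf_add.
by apply/ratio_eqP => /=; ring.
Qed.

Lemma tf_1neq0 : tofrac 1 != tofrac 0.
Proof.
by apply/eqP => /ratio_eqP /=; rewrite mul0r mulr1 => /eqP; rewrite oner_eq0.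
Qed.

HB.instance Definition _ := GRing.Zmodule_isComNzRing.Build Q
  tf_mulA tf_mulC tf_mul1 tf_mulDl tf_1neq0.

Lemma tofrac_zmod_morphism : zmod_morphism tofrac.
Proof.
move=> x y; rewrite [RHS](_ : _ = tf_add (tofrac x) (tf_opp (tofrac y))) //.
rewrite (pi_tf_opp (ratio_embed y)) pi_tf_add.
by apply/ratio_eqP => /=; ring.
Qed.

Lemma tofrac_monoid_morphism : monoid_morphism tofrac.
Proof.
split=> [//|x y]; rewrite [RHS](_ : _ = tf_mul (tofrac x) (tofrac y)) //.
rewrite pi_tf_mul.
by apply/ratio_eqP => /=; ring.
Qed.

HB.instance Definition _ :=
  GRing.isZmodMorphism.Build R Q tofrac tofrac_zmod_morphism.
HB.instance Definition _ :=
  GRing.isMonoidMorphism.Build R Q tofrac tofrac_monoid_morphism.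

End TotalFractionsRing.

Section TensorDef.
Variables (R S : comNzRingType) (phi : {rmorphism R -> S}) (M : lmodType R).

(* [tensor] is M ⊗_R S with its S-module structure.
   The sequence [:: (v_1, a_1); ...; (v_n, a_n)] stands for the formal sum of
   the v_i ⊗ a_i.  Congruence and [TensorComm] present the commutative monoid
   of such sums; the remaining rules are the bilinearity relations, with
   [TensorZero] making it a group. *)
Inductive tensor_rel : seq (M * S) -> seq (M * S) -> Prop :=
| TensorRefl s : tensor_rel s s
| TensorSym s t : tensor_rel s t -> tensor_rel t s
| TensorTrans s t r : tensor_rel s t -> tensor_rel t r -> tensor_rel s r
| TensorCat s s' t t' :
    tensor_rel s s' -> tensor_rel t t' -> tensor_rel (s ++ t) (s' ++ t')
| TensorComm s t : tensor_rel (s ++ t) (t ++ s)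
| TensorZero : tensor_rel [:: (0, 0)] [::]
| TensorAddl v w a : tensor_rel [:: (v + w, a)] [:: (v, a); (w, a)]
| TensorAddr v a b : tensor_rel [:: (v, a + b)] [:: (v, a); (v, b)]
| TensorBalanced r v a : tensor_rel [:: (r *: v, a)] [:: (v, phi r * a)].

Definition tensor_eq (s t : seq (M * S)) : bool := `[< tensor_rel s t >].

Lemma tensor_eq_refl : reflexive tensor_eq.
Proof. by move=> s; apply/asboolP; exact: TensorRefl. Qed.

Lemma tensor_eq_sym : symmetric tensor_eq.
Proof. by move=> s t; apply/asboolP/asboolP; exact: TensorSym. Qed.

Lemma tensor_eq_trans : transitive tensor_eq.
Proof.
by move=> t s r /asboolP st /asboolP tr; apply/asboolP; exact: TensorTrans tr.
Qed.

Canonical tensor_equiv :=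
  EquivRel tensor_eq tensor_eq_refl tensor_eq_sym tensor_eq_trans.

Definition tensor := {eq_quot tensor_eq}.

HB.instance Definition _ := EqQuotient.on tensor.
HB.instance Definition _ := Choice.on tensor.

Implicit Types (s t : seq (M * S)) (x y z : tensor).

Lemma tensorP s t : \pi_tensor s = \pi_tensor t <-> tensor_rel s t.
Proof.
split=> [/eqmodP /asboolP //|st]; apply/eqmodP; exact/asboolP.
Qed.

Lemma tensor_repr s : tensor_rel (repr (\pi_tensor s)) s.
Proof. by apply/tensorP; rewrite reprK. Qed.

Definition seq_opp s : seq (M * S) := [seq (- p.1, p.2) | p <- s].
Definition seq_scale (a : S) s : seq (M * S) := [seq (p.1, a * p.2) | p <- s].

Definition tensor0 : tensor := \pi_tensor [::].
Definition tensor_add x y : tensor := \pi_tensor (repr x ++ repr y).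
Definition tensor_opp x : tensor := \pi_tensor (seq_opp (repr x)).
Definition tensor_scale (a : S) x : tensor := \pi_tensor (seq_scale a (repr x)).

Lemma tensor_rel_opp s t :
  tensor_rel s t -> tensor_rel (seq_opp s) (seq_opp t).
Proof.
elim=> {s t} [s|s t _|s t r _ st _ tr|s s' t t' _ IHs _ IHt|s t||v w a|v a b|r v a].
- exact: TensorRefl.
- exact: TensorSym.
- exact: TensorTrans tr.
- by rewrite /seq_opp !map_cat; exact: TensorCat.
- by rewrite /seq_opp !map_cat; exact: TensorComm.
- by rewrite /= oppr0; exact: TensorZero.
- by rewrite /= opprD; exact: TensorAddl.
- exact: TensorAddr.
- by rewrite /= -scalerN; exact: TensorBalanced.
Qed.

Lemma tensor_rel_scale c s t :
  tensor_rel s t -> tensor_rel (seq_scale c s) (seq_scale c t).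
Proof.
elim=> {s t} [s|s t _|s t r _ st _ tr|s s' t t' _ IHs _ IHt|s t||v w a|v a b|r v a].
- exact: TensorRefl.
- exact: TensorSym.
- exact: TensorTrans tr.
- by rewrite /seq_scale !map_cat; exact: TensorCat.
- by rewrite /seq_scale !map_cat; exact: TensorComm.
- by rewrite /= mulr0; exact: TensorZero.
- exact: TensorAddl.
- by rewrite /= mulrDr; exact: TensorAddr.
- by rewrite /= mulrCA; exact: TensorBalanced.
Qed.

Lemma pi_tensor_add s t : tensor_add (\pi_tensor s) (\pi_tensor t) = \pi_tensor (s ++ t).
Proof. by apply/tensorP; apply: TensorCat; exact: tensor_repr. Qed.

Lemma pi_tensor_opp s : tensor_opp (\pi_tensor s) = \pi_tensor (seq_opp s).
Proof. by apply/tensorP; apply: tensor_rel_opp; exact: tensor_repr. Qed.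

Lemma pi_tensor_scale c s : tensor_scale c (\pi_tensor s) = \pi_tensor (seq_scale c s).
Proof. by apply/tensorP; apply: tensor_rel_scale; exact: tensor_repr. Qed.

Lemma tensor_addA : associative tensor_add.
Proof.
elim/quotW=> s; elim/quotW=> t; elim/quotW=> r.
by rewrite (pi_tensor_add t r) (pi_tensor_add s t) 2!pi_tensor_add catA.
Qed.

Lemma tensor_addC : commutative tensor_add.
Proof.
elim/quotW=> s; elim/quotW=> t; rewrite !pi_tensor_add.
by apply/tensorP; exact: TensorComm.
Qed.

Lemma tensor_add0 : left_id tensor0 tensor_add.
Proof. by elim/quotW=> s; rewrite pi_tensor_add. Qed.

Lemma tensor_rel_0l a : tensor_rel [:: (0, a)] [::].
Proof.
have := TensorBalanced 0 0 a; rewrite scaler0 rmorph0 mul0r => h.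
exact: TensorTrans h TensorZero.
Qed.

Lemma tensor_rel_oppK s : tensor_rel (seq_opp s ++ s) [::].
Proof.
elim: s => [|[v a] s IHs]; first exact: TensorRefl.
have h : tensor_rel [:: (- v, a); (v, a)] [::].
  apply: TensorTrans (tensor_rel_0l a); rewrite -(addNr v).
  exact/TensorSym/TensorAddl.
have c := TensorComm (seq_opp s) [:: (v, a)].
have := TensorCat (TensorRefl [:: (- v, a)]) (TensorCat c (TensorRefl s)).
rewrite -!catA /= => e; apply: TensorTrans e _.
exact: TensorCat h IHs.
Qed.

Lemma tensor_addN : left_inverse tensor0 tensor_opp tensor_add.
Proof.
elim/quotW=> s; rewrite (pi_tensor_opp s) pi_tensor_add.
by apply/tensorP; exact: tensor_rel_oppK.
Qed.

HB.instance Definition _ := GRing.isZmodule.Build tensor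
  tensor_addA tensor_addC tensor_add0 tensor_addN.

Lemma tensor_scaleA a b x :
  tensor_scale a (tensor_scale b x) = tensor_scale (a * b) x.
Proof.
elim/quotW: x => s.
rewrite (pi_tensor_scale b s) 2!pi_tensor_scale /seq_scale -map_comp.
by congr (\pi_tensor _); apply: eq_map => p /=; rewrite mulrA.
Qed.

Lemma tensor_scale1 : left_id 1 tensor_scale.
Proof.
elim/quotW=> s; rewrite pi_tensor_scale /seq_scale.
by congr (\pi_tensor _); rewrite -[RHS]map_id; apply: eq_map => -[v a] /=; rewrite mul1r.
Qed.

Lemma tensor_scaleDr : right_distributive tensor_scale +%R.
Proof.
move=> a; elim/quotW=> s; elim/quotW=> t.
rewrite -[RHS]/(tensor_add _ _) -[(X in tensor_scale a X)]/(tensor_add _ _).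
rewrite (pi_tensor_add s t) (pi_tensor_scale a s) (pi_tensor_scale a t).
by rewrite pi_tensor_scale pi_tensor_add /seq_scale map_cat.
Qed.

Lemma tensor_scaleDl x : {morph tensor_scale^~ x : a b / a + b}.
Proof.
move=> a b; elim/quotW: x => s; rewrite -[RHS]/(tensor_add _ _).
rewrite (pi_tensor_scale a s) (pi_tensor_scale b s).
rewrite pi_tensor_scale pi_tensor_add; apply/tensorP.
elim: s => [|[v c] s IHs]; first exact: TensorRefl.
rewrite /= -cat1s mulrDl.
apply: TensorTrans (TensorCat (TensorAddr v (a * c) (b * c)) IHs) _.
rewrite -[(v, a * c) :: _ ++ _]cat1s -[[:: _; _] ++ _]cat1s.
apply: TensorCat; first exact: TensorRefl.
rewrite /= -[_ :: _ ++ _]cat1s -[(v, b * c) :: seq_scale b s]cat1s !catA.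
by apply: TensorCat; [exact: TensorComm|exact: TensorRefl].
Qed.

HB.instance Definition _ := GRing.Zmodule_isLmodule.Build S tensor
  tensor_scaleA tensor_scale1 tensor_scaleDr tensor_scaleDl.

End TensorDef.

Definition constant_rank (R : comNzRingType) (M : lmodType R) (r : nat) : Prop :=
  exists f : {linear tensor (@tofrac R) M -> 'rV[total_fractions R]_r},
    bijective f.

Definition has_constant_rank (R : comNzRingType) (M : lmodType R) : Prop :=
  exists r, constant_rank M r.

Section Ext.
Variable R : comNzRingType.

Definition projective (P : lmodType R) : Prop :=
  forall (A B : lmodType R) (g : {linear A -> B}) (f : {linear P -> B}),
    (forall b, exists a, g a = b) ->
    exists h : {linear P -> A}, forall p, g (h p) = f p.

Record projective_resolution (M : lmodType R) := ProjectiveResolution {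
  res_mod :> nat -> lmodType R;
  res_diff : forall i, {linear res_mod i.+1 -> res_mod i};
  res_aug : {linear res_mod 0%N -> M};
  res_projective : forall i, projective (res_mod i);
  res_aug_surj : forall v, exists p, res_aug p = v;
  res_exact0 : forall p, res_aug p = 0 <-> exists q, res_diff 0%N q = p;
  res_exact : forall i p,
    res_diff i p = 0 <-> exists q, res_diff i.+1 q = p
}.

Variables M N : lmodType R.

Definition cocycle (P : projective_resolution M) (i : nat)
    (f : {linear P i -> N}) : Prop :=
  forall p, f (res_diff P i p) = 0.

Definition coboundary (P : projective_resolution M) (i : nat) :
    {linear P i -> N} -> Prop :=
  match i with
  | 0 => fun f => forall p, f p = 0
  | j.+1 => fun f =>
      exists g : {linear P j -> N}, forall p, f p = g (res_diff P j p)
  end.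

(* Ext^i_R(M, N) = H^i(Hom_R(P, N)) for a projective resolution P of M.  By the
   comparison theorem its vanishing does not depend on P. *)
Definition Ext_vanishes (i : nat) : Prop :=
  exists P : projective_resolution M,
    forall f : {linear P i -> N}, cocycle f -> coboundary f.

End Ext.

Section Conditions.
Variable R : comNzRingType.

Definition self_ext_implication (M : lmodType R) : Prop :=
  (forall i, (0 < i)%N -> Ext_vanishes M R^o i) ->
  (exists n, forall i, (n <= i)%N -> Ext_vanishes M M i) ->
  forall i, (0 < i)%N -> Ext_vanishes M M i.

Definition SAC : Prop :=
  forall M : lmodType R, finitely_generated M -> self_ext_implication M.

Definition SACC : Prop :=
  forall M : lmodType R, finitely_generated M -> has_constant_rank M ->
    self_ext_implication M.

End Conditions.

(* Main.v *)
(* Lift the matrices of a free resolution of M over S = R/xR to R; the lifted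
   differentials satisfy d d = x t.  The module K = ker (F_0 -> M), being the
   first syzygy of M over R, contains x F_0 and so has constant rank, and
   (a, b) |-> (a d + x b, - (a t + b d)) on F_(i+1) * F_i gives a free
   resolution of K over R.  Computing with it,
     Ext_R^i(K, R) = Ext_S^i(M, S) = 0  for i > 0,
     Ext_R^(i+1)(K, K) = Ext_R^i(K, M)  for i > 0,
     Ext_R^i(K, M) = 0  when  Ext_S^i(M, M) = Ext_S^(i+1)(M, M) = 0,
   so (SACC) applies to K and yields Ext_R^i(K, M) = 0 for all i > 0.  Then
   Ext_S^(i+2)(M, M) = 0 implies Ext_S^i(M, M) = 0, and one descends from the
   vanishing in large degrees. *)
Require Import Defs.
From HB Require Import structures.
From mathcomp Require Import all_boot all_algebra ring boolp classical_sets.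

Set Implicit Arguments.
Unset Strict Implicit.
Unset Printing Implicit Defensive.

Import GRing.Theory.
Local Open Scope ring_scope.
Local Open Scope quotient_scope.

Section LinearMaps.
Variable R : comNzRingType.
Implicit Types U V : lmodType R.

Lemma linear_pack U V (f : U -> V) :
  (forall a u v, f (a *: u + v) = a *: f u + f v) ->
  exists g : {linear U -> V}, forall u, g u = f u.
Proof.
move=> fL; pose mixin := GRing.isLinear.Build R U V *:%R f fL.
by exists (HB.pack f mixin : {linear U -> V}).
Qed.

End LinearMaps.

Section Pairs.
Variables (R : comNzRingType) (U V W : lmodType R).

Lemma linear_pair_split (f : {linear (U * V)%type -> W}) :
  exists (u : {linear U -> W}) (v : {linear V -> W}),
  forall a b, f (a, b) = u a + v b.
Proof.
have [|u uE] := @linear_pack _ U W (fun a => f (a, 0)).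
  move=> a p q; rewrite -linearP; congr (f _).
  by apply: injective_projections; rewrite /= ?scaler0 ?addr0.
have [|v vE] := @linear_pack _ V W (fun b => f (0, b)).
  move=> a p q; rewrite -linearP; congr (f _).
  by apply: injective_projections; rewrite /= ?scaler0 ?addr0.
exists u, v => a b; rewrite uE vE -linearD; congr (f _).
by apply: injective_projections; rewrite /= ?addr0 ?add0r.
Qed.

Lemma linear_pair_join (u : {linear U -> W}) (v : {linear V -> W}) :
  exists f : {linear (U * V)%type -> W}, forall a b, f (a, b) = u a + v b.
Proof.
have [|f fE] := @linear_pack _ (U * V)%type W (fun p => u p.1 + v p.2).
  by move=> a p q /=; rewrite !linearP scalerDr addrACA.
by exists f => a b; rewrite fE.
Qed.

End Pairs.

Section KernelModule.
Variables (R : comNzRingType) (U V : lmodType R) (f : {linear U -> V}).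

Definition in_kernel : {pred U} := [pred u | f u == 0].

Lemma in_kernel_submod_closed : submod_closed in_kernel.
Proof.
split=> [|a u v /eqP fu /eqP fv]; apply/eqP; first exact: linear0.
by rewrite linearP fu fv scaler0 addr0.
Qed.

HB.instance Definition _ :=
  GRing.isSubmodClosed.Build R U in_kernel in_kernel_submod_closed.

Record kernel_module := KernelModule {
  kernel_val : U; _ : kernel_val \in in_kernel }.

HB.instance Definition _ := [isSub for kernel_val].
HB.instance Definition _ := [Choice of kernel_module by <:].
HB.instance Definition _ := [SubChoice_isSubLmodule of kernel_module by <:].

Definition kernel_incl : {linear kernel_module -> U} := \val.

Lemma kernel_incl_inj : injective kernel_incl.
Proof. exact: val_inj. Qed.

Lemma kernel_inclE u : f (kernel_incl u) = 0.
Proof. by case: u => u /= /eqP. Qed.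

Lemma kernel_incl_ex u : f u = 0 -> exists v, kernel_incl v = u.
Proof. by move=> /eqP fu; exists (KernelModule fu). Qed.

Lemma kernel_lift (W : lmodType R) (g : {linear W -> U}) :
  (forall w, f (g w) = 0) ->
  exists h : {linear W -> kernel_module}, forall w, kernel_incl (h w) = g w.
Proof.
move=> fg; have inker w : g w \in in_kernel by exact/eqP.
have [|h hE] :=
  @linear_pack _ W kernel_module (fun w => KernelModule (inker w)).
  by move=> a u v; apply: val_inj; rewrite /= !linearP.
by exists h => w; rewrite hE.
Qed.

End KernelModule.

Arguments kernel_incl {R U V f} : simpl never.

(** * Projective modules and the comparison theorem *)

Section Lifting.
Variable R : comNzRingType.

Lemma projective_lift (P Q0 Q1 Q2 : lmodType R) (d1 : {linear Q1 -> Q0})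
    (d2 : {linear Q2 -> Q1}) (f : {linear P -> Q1}) :
  projective P -> (forall q, d1 q = 0 <-> exists q', d2 q' = q) ->
  (forall p, d1 (f p) = 0) ->
  exists h : {linear P -> Q2}, forall p, d2 (h p) = f p.
Proof.
move=> projP exQ d1f.
have d12 q : d1 (d2 q) = 0 by apply/exQ; exists q.
have [f' f'E] := kernel_lift d1f; have [d2' d2'E] := kernel_lift d12.
have [|h hE] := projP _ _ d2' f'.
  move=> b; have [q qE] := (exQ _).1 (kernel_inclE b); exists q.
  by apply: kernel_incl_inj; rewrite d2'E.
by exists h => p; rewrite -d2'E hE f'E.
Qed.

Lemma row_projective n : projective ('rV[R]_n : lmodType R).
Proof.
move=> A B g f gsurj; have [a aE] := choice (fun i => gsurj (f (delta_mx 0 i))).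
have [|h hE] :=
  @linear_pack _ 'rV[R]_n A (fun v : 'rV_n => \sum_i v 0 i *: a i).
  move=> c u v; rewrite scaler_sumr -big_split; apply: eq_bigr => i _ /=.
  by rewrite !mxE scalerDl scalerA.
exists h => v; rewrite hE linear_sum [in RHS](row_sum_delta v) linear_sum.
by apply: eq_bigr => i _; rewrite !linearZ_LR aE.
Qed.

Lemma prod_projective (P Q : lmodType R) :
  projective P -> projective Q -> projective (P * Q)%type.
Proof.
move=> projP projQ A B g f gsurj.
have [u [v uvE]] := linear_pair_split f.
have [u' u'E] := projP _ _ g u gsurj; have [v' v'E] := projQ _ _ g v gsurj.
have [h hE] := linear_pair_join u' v'.
by exists h => -[p q]; rewrite hE linearD u'E v'E uvE.
Qed.

End Lifting.

Section Comparison.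
Variables (R : comNzRingType) (M : lmodType R).

Lemma res_diff2 (P : projective_resolution M) i p :
  res_diff P i (res_diff P i.+1 p) = 0.
Proof. by apply/res_exact; exists p. Qed.

Lemma res_aug_diff (P : projective_resolution M) p :
  res_aug P (res_diff P 0 p) = 0.
Proof. by apply/res_exact0; exists p. Qed.

(* The chain maps and the homotopy of the comparison theorem are only needed in
   two consecutive degrees at a time, so no sequences of maps are chosen. *)
Lemma comparison (P Q : projective_resolution M) i :
  exists (u : {linear P i -> Q i}) (u' : {linear P i.+1 -> Q i.+1})
    (v : {linear Q i -> P i}) (v' : {linear Q i.+1 -> P i.+1})
    (s : {linear Q i -> Q i.+1}) (s' : {linear Q i.+1 -> Q i.+2}),
  [/\ forall p, res_diff Q i (u' p) = u (res_diff P i p),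
      forall q, res_diff P i (v' q) = v (res_diff Q i q) &
      forall q, res_diff Q i.+1 (s' q) = u' (v' q) - q - s (res_diff Q i q)].
Proof.
have projR (T : projective_resolution M) j := @res_projective _ _ T j.
have diff0 (T U : projective_resolution M) j (f : {linear T j -> U j})
    (f' : {linear T j.+1 -> U j.+1}) :
    (forall p, res_diff U j (f' p) = f (res_diff T j p)) ->
    exists f'' : {linear T j.+2 -> U j.+2},
    forall p, res_diff U j.+1 (f'' p) = f' (res_diff T j.+1 p).
  move=> fE; apply: (projective_lift (f := f' \o res_diff T j.+1)
    (projR _ _) (@res_exact _ _ U j)).
  by move=> p /=; rewrite fE res_diff2 linear0.
elim: i => [|i [u [u' [v [v' [s [s' [uE vE sE]]]]]]]].
- have aug0 (T U : projective_resolution M) :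
      exists f : {linear T 0%N -> U 0%N},
      forall p, res_aug U (f p) = res_aug T p.
    exact: (projR T 0%N) (@res_aug_surj _ _ U).
  have aug1 (T U : projective_resolution M) (f : {linear T 0%N -> U 0%N}) :
      (forall p, res_aug U (f p) = res_aug T p) ->
      exists f' : {linear T 1%N -> U 1%N},
      forall p, res_diff U 0 (f' p) = f (res_diff T 0 p).
    move=> fE; apply: (projective_lift (f := f \o res_diff T 0)
      (projR _ _) (@res_exact0 _ _ U)).
    by move=> p /=; rewrite fE res_aug_diff.
  have [u uE] := aug0 P Q; have [v vE] := aug0 Q P.
  have [u' u'E] := aug1 _ _ _ uE; have [v' v'E] := aug1 _ _ _ vE.
  pose h : {linear Q 0%N -> Q 0%N} := (u \o v) \- idfun.
  have [|s sE] := projective_lift (f := h) (projR _ _) (@res_exact0 _ _ Q).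
    by move=> q; rewrite /= linearB uE vE; exact: subrr.
  pose k : {linear Q 1%N -> Q 1%N} :=
    (u' \o v') \- idfun \- (s \o res_diff Q 0).
  have [|s' s'E] := projective_lift (f := k) (projR _ _) (@res_exact _ _ Q 0).
    by move=> q; rewrite /= !linearB u'E v'E sE /=; exact: subrr.
  by exists u, u', v, v', s, s'.
have [u'' u''E] := diff0 _ _ _ _ _ uE; have [v'' v''E] := diff0 _ _ _ _ _ vE.
exists u', u'', v', v'', s'.
pose k : {linear Q i.+2 -> Q i.+2} :=
  (u'' \o v'') \- idfun \- (s' \o res_diff Q i.+1).
have [|s'' s''E] :=
  projective_lift (f := k) (projR _ _) (@res_exact _ _ Q i.+1).
  move=> q; rewrite /= !linearB u''E v''E sE res_diff2 linear0 subr0.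
  exact: subrr.
by exists s''.
Qed.

Lemma Ext_vanishes_resolution (N : lmodType R) i (Q : projective_resolution M) :
  Ext_vanishes M N i.+1 ->
  forall f : {linear Q i.+1 -> N}, cocycle f -> coboundary f.
Proof.
move=> [P extP] f fd.
have [u [u' [v [v' [s [s' [uE vE sE]]]]]]] := comparison P Q i.
have [|g gE] := extP (f \o u').
  move=> p /=.
  have /res_exact[q <-] : res_diff Q i (u' (res_diff P i.+1 p)) = 0.
    by rewrite uE res_diff2 linear0.
  exact: fd.
exists ((g \o v) \- (f \o s)) => q /=; rewrite -vE -gE /=.
have := fd (s' q); rewrite sE !linearB addrAC => /eqP.
by rewrite subr_eq0 => /eqP.
Qed.

End Comparison.

(** * Submodules of free modules *)

Lemma noetherian_row_span (R : comNzRingType) (noethR : noetherian R) n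
    (W : set 'rV[R]_n) :
  W 0 -> (forall a u v, W u -> W v -> W (a *: u + v)) ->
  exists k (A : 'M[R]_(k, n)), forall v, W v <-> exists c : 'rV_k, v = c *m A.
Proof.
elim: n W => [|n IHn] W W0 WP.
  by exists 0%N, 0 => v; split=> [_|_]; [exists 0|]; rewrite [v]thinmx0 ?mulmx0.
have WZ a u : W u -> W (a *: u) by move=> Wu; rewrite -[_ *: _]addr0; apply: WP.
have WD u v : W u -> W v -> W (u + v).
  by move=> Wu Wv; rewrite -[u]scale1r; apply: WP.
pose hd : set R := fun a => exists w : 'rV_n, W (row_mx a%:M w : 'rV_(1 + n)).
have hd_ideal : ideal hd.
  split=> [|a b [u Wu] [v Wv]|a b [u Wu]].
  - by exists 0; rewrite raddf0 row_mx0.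
  - by exists (u + v); rewrite raddfD -add_row_mx; apply: WD.
  - by exists (a *: u); rewrite -scale_scalar_mx -scale_row_mx; apply: WZ.
have [s hdE] := noethR _ hd_ideal.
have hds (i : 'I_(size s)) : hd s`_i.
  rewrite hdE; exists (fun j : nat => (j == i)%:R).
  rewrite (bigD1 i) //= eqxx scale1r.
  by rewrite big1 ?addr0 // => j /negPf ji; rewrite [(j : nat) == i]ji scale0r.
have [w ww] := choice hds.
pose tl : set 'rV_n := fun v => W (row_mx (0 : 'rV_1) v : 'rV_(1 + n)).
have [||k [A AE]] := IHn tl.
- by rewrite /tl row_mx0.
- move=> a u v tu tv; rewrite /tl -[X in row_mx X](addr0 (0 : 'rV_1)).
  rewrite -[X in row_mx (X + _)](scaler0 _ a) -add_row_mx -scale_row_mx.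
  exact: WP.
pose C : 'M_(size s, n) := \matrix_i w i.
pose B : 'M_(size s, 1 + n) := row_mx (\col_i s`_i) C.
have WB (c : 'rV_(size s)) : W (c *m B).
  rewrite mulmx_sum_row; elim/big_ind: _ => // i _; apply: WZ.
  rewrite row_row_mx rowK (_ : row i _ = (s`_i)%:M); first exact: ww.
  by apply/rowP => j; rewrite ord1 !mxE eqxx.
pose D : 'M_(k, 1 + n) := row_mx 0 A.
have DE (c : 'rV_k) : c *m D = row_mx 0 (c *m A) by rewrite mul_mx_row mulmx0.
exists (size s + k)%N, (col_mx B D) => v; split.
  move=> Wv; have vE : v = row_mx (v 0 0)%:M (rsubmx (v : 'rV_(1 + n))).
    rewrite (_ : _%:M = lsubmx (v : 'rV_(1 + n))) ?hsubmxK //.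
    by apply/rowP => i; rewrite ord1 !mxE eqxx; congr (v _ _); apply: val_inj.
  have : hd (v 0 0) by exists (rsubmx (v : 'rV_(1 + n))); rewrite -vE.
  rewrite hdE => -[c cE]; pose c' : 'rV_(size s) := \row_i c i.
  have cB : c' *m B = row_mx (v 0 0)%:M (c' *m C).
    rewrite mul_mx_row; congr row_mx; apply/rowP => j.
    by rewrite ord1 cE !mxE eqxx mulr1n; apply: eq_bigr => i _; rewrite !mxE.
  have /AE[e eE] : tl (rsubmx (v : 'rV_(1 + n)) - c' *m C).
    rewrite /tl (_ : row_mx _ _ = - 1 *: (c' *m B) + v); first exact: WP.
    by rewrite [in RHS]vE cB scaleN1r opp_row_mx add_row_mx addNr addrC.
  exists (row_mx c' e); rewrite mul_row_col cB DE -eE.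
  apply: etrans (esym (@add_row_mx _ 1 1 n _ _ _ _)).
  by rewrite addr0 addrC subrK -vE.
move=> [c ->]; rewrite -[c]hsubmxK mul_row_col; apply: WD => //.
by rewrite DE; apply/AE; exists (rsubmx c).
Qed.

Section KernelRank.
Variables (R : comNzRingType) (x : R) (regx : GRing.lreg x).
Variables (n : nat) (M : lmodType R) (e : {linear 'rV[R]_n -> M}).
Hypothesis xM : forall v : M, x *: v = 0.

Local Notation Q := (total_fractions R).
Local Notation K := (kernel_module e).
Local Notation T := (tensor (@Defs.tofrac R) K).

Definition pure_tensor (v : K) (a : Q) : T := \pi_T [:: (v, a)].

Lemma pi_tensor_sum s : \pi_T s = \sum_(p <- s) pure_tensor p.1 p.2.
Proof.
elim: s => [|p s IHs]; first by rewrite big_nil.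
rewrite big_cons -IHs; apply: esym; rewrite -[_ :: s]cat1s -pi_tensor_add.
by case: p.
Qed.

Lemma pure_tensorDr v a b :
  pure_tensor v (a + b) = pure_tensor v a + pure_tensor v b.
Proof.
rewrite [RHS](_ : _ = tensor_add (pure_tensor v a) (pure_tensor v b)) //.
by rewrite pi_tensor_add; apply/tensorP; exact: TensorAddr.
Qed.

Lemma pure_tensorDl v w a :
  pure_tensor (v + w) a = pure_tensor v a + pure_tensor w a.
Proof.
rewrite [RHS](_ : _ = tensor_add (pure_tensor v a) (pure_tensor w a)) //.
by rewrite pi_tensor_add; apply/tensorP; exact: TensorAddl.
Qed.

Lemma pure_tensorZl r v a :
  pure_tensor (r *: v) a = pure_tensor v (Defs.tofrac r * a).
Proof. by apply/tensorP; exact: TensorBalanced. Qed.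

Lemma pure_tensor0l a : pure_tensor 0 a = 0.
Proof. by apply: (addrI (pure_tensor 0 a)); rewrite -pure_tensorDl !addr0. Qed.

Lemma pure_tensor_suml I r (F : I -> K) a :
  pure_tensor (\sum_(i <- r) F i) a = \sum_(i <- r) pure_tensor (F i) a.
Proof.
elim/big_rec2: _ => [|i y1 y2 _ <-]; first exact: pure_tensor0l.
exact: pure_tensorDl.
Qed.

Definition eval_formal (s : seq (K * Q)) : 'rV[Q]_n :=
  \sum_(p <- s) p.2 *: map_mx (@Defs.tofrac R) (kernel_incl p.1).

Lemma eval_formal1 v a :
  eval_formal [:: (v, a)] = a *: map_mx (@Defs.tofrac R) (kernel_incl v).
Proof. exact: big_seq1. Qed.

Lemma eval_formal_cat s t :
  eval_formal (s ++ t) = eval_formal s + eval_formal t.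
Proof. exact: big_cat. Qed.

Lemma eval_formal_rel s t :
  tensor_rel (@Defs.tofrac R) s t -> eval_formal s = eval_formal t.
Proof.
elim=> {s t}
  [s|s t _|s t r _ st _ tr|s s' t t' _ IHs _ IHt|s t||v w a|v a b|r v a].
- by [].
- by [].
- by rewrite st.
- by rewrite !eval_formal_cat IHs IHt.
- by rewrite !eval_formal_cat addrC.
- by rewrite eval_formal1 scale0r [RHS]big_nil.
- rewrite [RHS](eval_formal_cat [:: _] [:: _]) !eval_formal1.
  by rewrite linearD map_mxD scalerDr.
- by rewrite [RHS](eval_formal_cat [:: _] [:: _]) !eval_formal1 scalerDl.
- by rewrite !eval_formal1 linearZ map_mxZ scalerA mulrC.
Qed.

Lemma kernel_constant_rank : constant_rank K n.
Proof.
have [y xy] : exists y : Q, Defs.tofrac x * y = 1.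
  exists (\pi_Q (ratio_of 1 regx)).
  rewrite [LHS](_ : _ = tf_mul (Defs.tofrac x) (\pi_Q (ratio_of 1 regx))) //.
  by rewrite pi_tf_mul; apply/ratio_eqP => /=; ring.
pose f0 (z : T) := eval_formal (repr z).
have f0E s : f0 (\pi_T s) = eval_formal s.
  by apply: eval_formal_rel; exact: tensor_repr.
have f0Z a z : f0 (a *: z) = a *: f0 z.
  elim/quotW: z => s; rewrite [X in f0 X](pi_tensor_scale _ a s) !f0E.
  rewrite /eval_formal big_map scaler_sumr; apply: eq_bigr => p _.
  by rewrite scalerA.
have f0D z t : f0 (z + t) = f0 z + f0 t.
  elim/quotW: z => s; elim/quotW: t => t.
  by rewrite [X in f0 X](pi_tensor_add _ s t) !f0E eval_formal_cat.
have [|f fE] := @linear_pack _ T 'rV[Q]_n f0.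
  by move=> a u v; rewrite f0D f0Z.
have [|b bE] :=
  kernel_lift (f := e) (g := *:%R x : {linear 'rV[R]_n -> 'rV[R]_n}).
  by move=> v; rewrite linearZ_LR xM.
pose g (w : 'rV[Q]_n) := \sum_i pure_tensor (b (delta_mx 0 i)) (w 0 i * y).
have gD v w : g (v + w) = g v + g w.
  rewrite -big_split; apply: eq_bigr => i _.
  by rewrite mxE mulrDl pure_tensorDr.
have g0 : g 0 = 0 by apply: (addrI (g 0)); rewrite -gD !addr0.
have f_pure v a :
    f (pure_tensor v a) = a *: map_mx (@Defs.tofrac R) (kernel_incl v).
  by rewrite fE f0E eval_formal1.
exists f; exists g => [z|w].
  elim/quotW: z => s; rewrite pi_tensor_sum linear_sum.
  rewrite (big_morph g gD g0); apply: eq_bigr => -[v a] _ /=.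
  rewrite f_pure /g.
  under eq_bigr => i _ do
    rewrite !mxE [a * _]mulrC -mulrA -pure_tensorZl.
  rewrite -pure_tensor_suml.
  rewrite (_ : \sum_i _ = x *: v); last first.
    apply: kernel_incl_inj; rewrite linear_sum linearZ_LR.
    rewrite [in RHS](row_sum_delta (kernel_incl v)) scaler_sumr.
    by apply: eq_bigr => i _; rewrite linearZ_LR bE !scalerA mulrC.
  by rewrite pure_tensorZl mulrCA xy mulr1.
rewrite linear_sum [RHS]row_sum_delta; apply: eq_bigr => i _.
rewrite f_pure bE map_mxZ map_delta_mx scalerA.
by rewrite -mulrA [y * _]mulrC xy mulr1.
Qed.

End KernelRank.

(** * Change of rings *)

(* The phantom argument keeps R-structures along different morphisms apart. *)
Definition restrict (R S : comNzRingType) (_ : {rmorphism R -> S})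
  (N : lmodType S) : Type := N.

Section Restriction.
Variables (R S : comNzRingType) (phi : {rmorphism R -> S}) (N : lmodType S).

HB.instance Definition _ := GRing.Zmodule.copy (restrict phi N) N.
Local Notation N_R := (restrict phi N).

Definition restrict_scale (a : R) (v : N_R) : N_R := phi a *: (v : N).

Lemma restrict_scaleA a b v :
  restrict_scale a (restrict_scale b v) = restrict_scale (a * b) v.
Proof. by rewrite /restrict_scale scalerA rmorphM. Qed.

Lemma restrict_scale1 : left_id 1 restrict_scale.
Proof. by move=> v; rewrite /restrict_scale rmorph1 scale1r. Qed.

Lemma restrict_scaleDr : right_distributive restrict_scale +%R.
Proof. by move=> a u v; rewrite /restrict_scale scalerDr. Qed.

Lemma restrict_scaleDl v : {morph restrict_scale^~ v : a b / a + b}.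
Proof. by move=> a b; rewrite /restrict_scale rmorphD scalerDl. Qed.

HB.instance Definition _ := GRing.Zmodule_isLmodule.Build R N_R
  restrict_scaleA restrict_scale1 restrict_scaleDr restrict_scaleDl.

Lemma restrictZ (a : R) (v : N_R) : a *: v = (phi a *: (v : N) : N_R).
Proof. by []. Qed.

Lemma extend_linear n (f : {linear 'rV[R]_n -> N_R}) :
  exists g : {linear 'rV[S]_n -> N}, forall v, g (map_mx phi v) = f v.
Proof.
have [|g gE] :=
  @linear_pack _ 'rV[S]_n N (fun v => \sum_i v 0 i *: (f (delta_mx 0 i) : N)).
  move=> c u v; rewrite scaler_sumr -big_split; apply: eq_bigr => i _ /=.
  by rewrite !mxE scalerDl scalerA.
exists g => v; rewrite gE [in RHS](row_sum_delta v) linear_sum.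
by apply: eq_bigr => i _; rewrite linearZ_LR mxE.
Qed.

Lemma restrict_linear n (g : {linear 'rV[S]_n -> N}) :
  exists f : {linear 'rV[R]_n -> N_R}, forall v, f v = g (map_mx phi v).
Proof.
by apply: linear_pack => a u v; rewrite map_mxD map_mxZ linearP.
Qed.

End Restriction.

Section LiftedResolution.
Variables (R S : comNzRingType) (phi : {rmorphism R -> S}) (x : R).
Hypothesis phi_surj : forall b, exists a, phi a = b.
Hypothesis noethR : noetherian R.
Variable M : lmodType S.

Lemma free_cover : finitely_generated M ->
  exists n (e : {linear 'rV[R]_n -> restrict phi M}),
  forall m, exists v, e v = m.
Proof.
case=> s sM; exists (size s).
have [|e eE] := @linear_pack _ 'rV[R]_(size s) (restrict phi M)
    (fun v => \sum_i v 0 i *: (s`_i : restrict phi M)).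
  move=> c u v; rewrite scaler_sumr -big_split; apply: eq_bigr => i _ /=.
  by rewrite !mxE scalerDl scalerA.
exists e => m; have [c ->] := sM m; have [a aE] := choice phi_surj.
exists (\row_i a (c i)); rewrite eE; apply: eq_bigr => i _.
by rewrite mxE restrictZ aE.
Qed.

Lemma divisible_coords k (v : 'rV[R]_k) :
  (forall i, exists b, v 0 i = x * b) -> exists w, v = x *: w.
Proof.
move=> /choice[b bE]; exists (\row_i b i).
by apply/rowP => i; rewrite bE !mxE.
Qed.

Lemma lifted_free_resolution : finitely_generated M ->
  exists (n : nat -> nat) (e : {linear 'rV[R]_(n 0) -> restrict phi M})
    (d : forall i, 'M[R]_(n i.+1, n i)) (t : forall i, 'M[R]_(n i.+2, n i)),
  [/\ forall m, exists v, e v = m,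
      forall v, e v = 0 <-> exists c, v = c *m d 0%N,
      forall i (v : 'rV[R]_(n i.+1)),
        (exists w, v *m d i = x *: w) <-> exists c, v = c *m d i.+1 &
      forall i, d i.+1 *m d i = x *: t i].
Proof.
move=> /free_cover[n0 [e esurj]].
have [||n1 [d0 d0E]] := noetherian_row_span noethR (W := fun v => e v = 0).
- exact: linear0.
- by move=> a u v eu ev; rewrite linearP eu ev scaler0 addr0.
pose state := {a : nat & {b : nat & 'M[R]_(b, a)}}.
have step (T : state) : exists B : {k : nat & 'M[R]_(k, projT1 (projT2 T))},
    forall v : 'rV_(projT1 (projT2 T)),
    (exists w, v *m projT2 (projT2 T) = x *: w) <-> exists c, v = c *m projT2 B.
  have [||k [A AE]] := noetherian_row_span noethR
    (W := fun v : 'rV_(projT1 (projT2 T)) =>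
            exists w, v *m projT2 (projT2 T) = x *: w).
  - by exists 0; rewrite mul0mx scaler0.
  - move=> a u v [w wE] [w' w'E]; exists (a *: w + w').
    by rewrite mulmxDl -scalemxAl wE w'E scalerDr !scalerA mulrC.
  by exists (existT _ k A).
pose nxt T := projT1 (cid (step T)).
pose st i : state := iter i
  (fun T =>
     existT (fun a => {b : nat & 'M[R]_(b, a)}) (projT1 (projT2 T)) (nxt T))
  (existT _ n0 (existT _ n1 d0)).
pose n i := projT1 (st i).
pose d i : 'M[R]_(n i.+1, n i) := projT2 (projT2 (st i)).
have dE i (v : 'rV_(n i.+1)) :
    (exists w, v *m d i = x *: w) <-> exists c, v = c *m d i.+1.
  exact: projT2 (cid (step (st i))) v.
have tE i : exists t : 'M[R]_(n i.+2, n i), d i.+1 *m d i = x *: t.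
  have rowE j : exists w, row j (d i.+1 *m d i) = x *: w.
    by rewrite row_mul; apply/dE; exists (delta_mx 0 j); rewrite -rowE.
  have [w wE] := choice rowE; exists (\matrix_j w j).
  by apply/row_matrixP => j; rewrite wE linearZ_LR /= rowK.
have [t tE'] : exists t : forall i, 'M[R]_(n i.+2, n i),
    forall i, d i.+1 *m d i = x *: t i.
  exists (fun i => projT1 (cid (tE i))) => i; exact: projT2 (cid (tE i)).
by exists n, e, d, t.
Qed.

End LiftedResolution.

Section Cohomology.
Variables (R S : comNzRingType) (phi : {rmorphism R -> S}) (x : R).
Hypothesis phi_surj : forall b, exists a, phi a = b.
Hypothesis phi_ker : forall a, phi a = 0 <-> exists b, a = x * b.
Hypothesis regx : GRing.lreg x.
Variable M : lmodType S.
Variables (n : nat -> nat) (e : {linear 'rV[R]_(n 0) -> restrict phi M}).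
Variables (d : forall i, 'M[R]_(n i.+1, n i)).
Variables (t : forall i, 'M[R]_(n i.+2, n i)).
Hypothesis esurj : forall m, exists v, e v = m.
Hypothesis eker : forall v, e v = 0 <-> exists c, v = c *m d 0%N.
Hypothesis dker :
  forall i (v : 'rV[R]_(n i.+1)),
  (exists w, v *m d i = x *: w) <-> exists c, v = c *m d i.+1.
Hypothesis dd : forall i, d i.+1 *m d i = x *: t i.

Local Notation F i := ('rV[R]_(n i)).
Local Notation K := (kernel_module e).

Lemma scale_regular k l : injective ( *:%R x : 'M[R]_(k, l) -> 'M[R]_(k, l)).
Proof.
move=> u v /matrixP uv; apply/matrixP => i j; apply: regx.
by have := uv i j; rewrite !mxE.
Qed.

Lemma restrict_kills (N : lmodType S) (v : restrict phi N) : x *: v = 0.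
Proof.
have x0 : phi x = 0 by apply/phi_ker; exists 1; rewrite mulr1.
by rewrite restrictZ x0; apply: (@scale0r _ N).
Qed.

Lemma lift_row k (v : 'rV[S]_k) : exists w : 'rV[R]_k, map_mx phi w = v.
Proof.
have [a aE] := choice phi_surj; exists (map_mx a v).
by apply/rowP => i; rewrite !mxE.
Qed.

Lemma map_row_eq0 k (v : 'rV[R]_k) :
  map_mx phi v = 0 <-> exists w, v = x *: w.
Proof.
split=> [/rowP v0|[w ->]].
  apply: divisible_coords => i; apply/phi_ker.
  by have := v0 i; rewrite !mxE.
apply/rowP => i; rewrite !mxE; apply/phi_ker.
by exists (w 0 i).
Qed.

Lemma diff_homotopyC i : d i.+2 *m t i = t i.+1 *m d i.
Proof.
have xdt : x *: (d i.+2 *m t i) = x *: (t i.+1 *m d i).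
  by rewrite scalemxAr -dd scalemxAl -dd mulmxA.
exact: scale_regular xdt.
Qed.

Definition reduced_aug := projT1 (cid (extend_linear e)).

Lemma reduced_augE v : reduced_aug (map_mx phi v) = e v.
Proof. exact: (projT2 (cid (extend_linear e))). Qed.

Definition reduced_resolution : projective_resolution M.
Proof.
apply: (@ProjectiveResolution _ M (fun i => 'rV[S]_(n i))
  (fun i => mulmxr (map_mx phi (d i))) reduced_aug).
- by move=> i; apply: row_projective.
- move=> m; have [v <-] := esurj m.
  by exists (map_mx phi v); rewrite reduced_augE.
- move=> p; have [v <-] := lift_row p; rewrite reduced_augE eker.
  split=> [[c ->]|[q]].
    by exists (map_mx phi c); rewrite /= map_mxM.
  have [c <-] := lift_row q; rewrite /= -map_mxM => /eqP.
  rewrite -subr_eq0 -map_mxB => /eqP/map_row_eq0[w wE].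
  apply/eker; rewrite -[v](subKr (c *m d 0)) wE.
  rewrite linearB linearZ_LR restrict_kills subr0.
  by apply/eker; exists c.
- move=> i p; have [v <-] := lift_row p; rewrite /= -map_mxM map_row_eq0 dker.
  split=> [[c ->]|[q]].
    by exists (map_mx phi c); rewrite /= map_mxM.
  have [c <-] := lift_row q; rewrite /= -map_mxM => /eqP.
  rewrite -subr_eq0 -map_mxB => /eqP/map_row_eq0[w wE].
  apply/dker; rewrite -[v](subKr (c *m d i.+1)) wE.
  exists (c *m t i - w *m d i).
  by rewrite mulmxBl -mulmxA dd -scalemxAl -scalemxAr scalerBr.
Defined.

(* [Ext^(j+1)_S(M, N) = 0], computed from the matrices over [R]. *)
Definition reduced_exact (N : lmodType S) j : Prop :=
  forall f : {linear F j.+1 -> restrict phi N},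
  (forall v, f (v *m d j.+1) = 0) ->
  exists g : {linear F j -> restrict phi N}, forall v, f v = g (v *m d j).

Lemma reduced_exactP (N : lmodType S) j :
  Ext_vanishes M N j.+1 <-> reduced_exact N j.
Proof.
split=> [extN f fd|exN].
  have [f' f'E] := extend_linear f.
  have [|g gE] :=
    Ext_vanishes_resolution (Q := reduced_resolution) extN (f := f').
    move=> p; have [v <-] := lift_row p.
    by rewrite /= -map_mxM f'E fd.
  have [g' g'E] := restrict_linear phi g; exists g' => v.
  by rewrite -f'E g'E map_mxM gE.
exists reduced_resolution => f fd.
have [f' f'E] := restrict_linear phi f.
have [|g gE] := exN f'.
  move=> v; rewrite f'E map_mxM; exact: fd.
have [g' g'E] := extend_linear g; exists g' => p.
have [v <-] := lift_row p.
by rewrite /= -map_mxM g'E -gE f'E.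
Qed.

Lemma scale_subset_kernel v : e (x *: v) = 0.
Proof. by rewrite linearZ_LR restrict_kills. Qed.

Local Notation P i := (F i.+1 * F i)%type.

Definition cone_diff i (p : P i.+1) : P i :=
  (p.1 *m d i.+1 + x *: p.2, - (p.1 *m t i + p.2 *m d i)).

Lemma cone_diff_is_linear i : linear (@cone_diff i).
Proof.
move=> a p q; apply: injective_projections; rewrite /= !mulmxDl -!scalemxAl.
  by rewrite !scalerDr !scalerA [x * a]mulrC addrACA.
by rewrite scalerN scalerDr -opprD addrACA.
Qed.

HB.instance Definition _ i :=
  GRing.isLinear.Build R (P i.+1) (P i) *:%R (@cone_diff i)
    (@cone_diff_is_linear i).

Lemma cone_diff_fst i (p : P i.+1) :
  (cone_diff p).1 *m d i + x *: (cone_diff p).2 = 0.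
Proof.
rewrite /= mulmxDl -mulmxA dd -scalemxAl -scalemxAr scalerN scalerDr.
exact: subrr.
Qed.

Lemma cone_diff2 i (p : P i.+2) : cone_diff (cone_diff p) = 0.
Proof.
apply: injective_projections; rewrite /=; first exact: cone_diff_fst.
rewrite mulNmx !mulmxDl -!mulmxA dd diff_homotopyC -scalemxAl -scalemxAr opprD.
exact: subrr.
Qed.

Lemma cone_exact i (p : P i) :
  p.1 *m d i + x *: p.2 = 0 -> exists q : P i.+1, cone_diff q = p.
Proof.
move: p => [a b] /= /eqP; rewrite addr_eq0 -scalerN => /eqP ad.
have [|c aE] := (dker a).1; first by exists (- b).
exists (c, 0).
apply: injective_projections; rewrite /= ?scaler0 ?mul0mx addr0 //.
rewrite -[b]opprK; congr (- _); apply: scale_regular.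
by rewrite -ad aE -mulmxA dd -scalemxAr.
Qed.

Definition cone_aug_val (p : P 0) : 'rV[R]_(n 0) := p.1 *m d 0 + x *: p.2.

Lemma cone_aug_val_is_linear : linear cone_aug_val.
Proof.
move=> a p q; rewrite /cone_aug_val /= mulmxDl -scalemxAl.
by rewrite !scalerDr !scalerA [x * a]mulrC addrACA.
Qed.

HB.instance Definition _ :=
  GRing.isLinear.Build R (P 0) 'rV[R]_(n 0) *:%R cone_aug_val
    cone_aug_val_is_linear.

Lemma cone_aug_val_kernel p : e (cone_aug_val p) = 0.
Proof.
rewrite linearD scale_subset_kernel addr0.
by apply/eker; exists p.1.
Qed.

Definition cone_aug := projT1 (cid (kernel_lift cone_aug_val_kernel)).

Lemma cone_augE p : kernel_incl (cone_aug p) = p.1 *m d 0 + x *: p.2.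
Proof. exact: (projT2 (cid (kernel_lift cone_aug_val_kernel))). Qed.

Definition cone_resolution : projective_resolution K.
Proof.
apply: (@ProjectiveResolution _ K
  (fun i => P i) (fun i => @cone_diff i) cone_aug).
- by move=> i; apply: prod_projective; apply: row_projective.
- move=> v; have /eker[c cE] := kernel_inclE v.
  by exists (c, 0); apply: kernel_incl_inj; rewrite cone_augE scaler0 addr0.
- move=> p; split=> [p0|[q <-]].
    by apply: cone_exact; rewrite -cone_augE p0 linear0.
  by apply: kernel_incl_inj; rewrite cone_augE cone_diff_fst linear0.
- move=> i p; split=> [p0|[q <-]]; last exact: cone_diff2.
  by apply: cone_exact; apply: (congr1 fst p0).
Defined.

(* [Ext^(j+1)_R(K, N) = 0]. *)
Definition cone_exact_at (N : lmodType R) j : Prop :=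
  forall f : {linear P j.+1 -> N}, (forall p, f (cone_diff p) = 0) ->
  exists g : {linear P j -> N}, forall p, f p = g (cone_diff p).

Lemma cone_exact_atP (N : lmodType R) j :
  Ext_vanishes K N j.+1 <-> cone_exact_at N j.
Proof.
split=> [extN f fd|exN]; last by exists cone_resolution.
exact: (Ext_vanishes_resolution (Q := cone_resolution) extN fd).
Qed.

Lemma cone_exact_ring j :
  reduced_exact (S^o : lmodType S) j -> cone_exact_at R^o j.
Proof.
move=> exS f fd; have [u [g fE]] := linear_pair_split f.
have ug a b : u (a *m d j.+2 + x *: b) = g (a *m t j.+1 + b *m d j.+1).
  by apply/eqP; rewrite -subr_eq0 -linearN -fE; apply/eqP; apply: (fd (a, b)).
have xu b : x * u b = g (b *m d j.+1).
  by have := ug 0 b; rewrite !mul0mx !add0r linearZ_LR.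
have [gS gSE] : exists gS : {linear F j.+1 -> restrict phi S^o},
    forall v, gS v = phi (g v).
  by apply: linear_pack => a p q; rewrite linearP rmorphD rmorphM.
have [|hS hSE] := exS gS.
  by move=> v; rewrite gSE -xu; apply/phi_ker; exists (u v).
have [phiL phiLE] : exists phiL : {linear R^o -> restrict phi S^o},
    forall a, phiL a = phi a.
  by apply: linear_pack => a p q; rewrite rmorphD rmorphM.
have [|h hE] := @row_projective R (n j) _ _ phiL hS.
  by move=> b; have [a aE] := phi_surj b; exists a; rewrite phiLE.
have kex v : exists b, g v = h (v *m d j) + x * b.
  have [b bE] : exists b, g v - h (v *m d j) = x * b.
    by apply/phi_ker; rewrite rmorphB -gSE hSE -hE phiLE subrr.
  by exists b; rewrite -bE addrC subrK.
have [k0 k0E] := choice kex.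
have [|k kE] := @linear_pack _ (F j.+1) R^o k0.
  move=> a p q; apply: regx.
  have := k0E (a *: p + q).
  rewrite linearP !k0E mulmxDl -scalemxAl linearP => /eqP.
  rewrite scalerDr addrACA (inj_eq (addrI _)) => /eqP <-.
  by rewrite mulrDr mulrCA.
have uE b : u b = h (b *m t j) + k (b *m d j.+1).
  apply: regx; rewrite xu k0E -mulmxA dd -scalemxAr linearZ_LR kE.
  by rewrite mulrDr.
have [f' f'E] := linear_pair_join k (\- h : {linear F j -> R^o}).
exists f' => -[a b]; rewrite fE [RHS]f'E /= linearN opprK !linearD linearZ_LR.
by rewrite uE k0E -kE addrACA addrC.
Qed.

Lemma cone_exact_module (N : lmodType S) j :
  reduced_exact N j -> reduced_exact N j.+1 -> cone_exact_at (restrict phi N) j.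
Proof.
move=> exj exj1 f fd; have [u [g fE]] := linear_pair_split f.
have ug a b : u (a *m d j.+2 + x *: b) = g (a *m t j.+1 + b *m d j.+1).
  by apply/eqP; rewrite -subr_eq0 -linearN -fE; apply/eqP; apply: (fd (a, b)).
have [|h hE] := exj g.
  move=> b; have := ug 0 b; rewrite !mul0mx !add0r linearZ_LR => <-.
  exact: restrict_kills.
have [|k kE] := exj1 (u \- (h \o mulmxr (t j))).
  move=> a /=; have := ug a 0; rewrite scaler0 mul0mx !addr0 => ->.
  by rewrite hE -!mulmxA diff_homotopyC subrr.
have uE b : u b = h (b *m t j) + k (b *m d j.+1).
  by rewrite -kE /= addrC subrK.
have [f' f'E] := linear_pair_join k (\- h : {linear F j -> restrict phi N}).
exists f' => -[a b]; rewrite fE [RHS]f'E /= linearN opprK !linearD linearZ_LR.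
by rewrite restrict_kills addr0 uE hE [h _ + _]addrC -addrA.
Qed.

Lemma reduced_exact_descent (N : lmodType S) j :
  reduced_exact N j.+2 -> cone_exact_at (restrict phi N) j -> reduced_exact N j.
Proof.
move=> exj2 exK f fd.
have [|g gE] := exj2 (f \o mulmxr (t j.+1)).
  by move=> v /=; rewrite -mulmxA diff_homotopyC mulmxA fd.
have [f' f'E] := linear_pair_join g f.
have [|k kE] := exK f'.
  move=> [a b]; rewrite f'E /= linearN [f _]linearD [g _]linearD linearZ_LR.
  rewrite fd restrict_kills -gE !addr0; exact: subrr.
have [k1 [k2 kE']] := linear_pair_split k.
exists (\- k2 : {linear F j -> restrict phi N}) => v.
have := kE (0, v); rewrite f'E linear0 add0r => ->.
rewrite /cone_diff /= !mul0mx !add0r kE' linearZ_LR restrict_kills add0r.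
by rewrite linearN.
Qed.

Lemma cone_exact_rows j k : cone_exact_at R^o j -> cone_exact_at 'rV[R]_k j.
Proof.
move=> exR f fd.
have coord i : exists g : {linear P j -> R^o},
    forall p, f p 0 i = g (cone_diff p).
  have [fi fiE] : exists fi : {linear P j.+1 -> R^o}, forall p, fi p = f p 0 i.
    by apply: linear_pack => a p q; rewrite linearP !mxE.
  have [|g gE] := exR fi; first by move=> p; rewrite fiE fd mxE.
  by exists g => p; rewrite -fiE.
have [g gE] := choice coord.
have [|G GE] := @linear_pack _ (P j) 'rV[R]_k (fun p => \row_i g i p).
  by move=> a p q; apply/rowP => i; rewrite !mxE linearP.
by exists G => p; apply/rowP => i; rewrite GE mxE gE.
Qed.

Lemma cone_projective j : projective (P j).
Proof. by apply: prod_projective; apply: row_projective. Qed.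

Lemma cone_exact_kernel j : (forall i, cone_exact_at 'rV[R]_(n 0) i) ->
  cone_exact_at (restrict phi M) j <-> cone_exact_at K j.+1.
Proof.
move=> exF; split=> exN f fd.
  have [|g gE] := exF j.+1 (kernel_incl \o f).
    by move=> p; rewrite -[LHS]/(kernel_incl (f (cone_diff p))) fd linear0.
  have [|h hE] := exN (e \o g).
    by move=> p /=; rewrite -gE; apply: kernel_inclE.
  have [h' h'E] := @cone_projective j _ _ e h esurj.
  have [|r rE] := kernel_lift (f := e) (g := g \- (h' \o @cone_diff j)).
    by move=> p /=; rewrite linearB h'E -hE; apply: subrr.
  exists r => p; apply: kernel_incl_inj; rewrite rE /= cone_diff2 linear0 subr0.
  by rewrite -gE.
have [g gE] := @cone_projective j.+1 _ _ e f esurj.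
have [|h hE] := kernel_lift (f := e) (g := g \o @cone_diff j.+1).
  by move=> p /=; rewrite gE fd.
have [|r rE] := exN h.
  by move=> p; apply: kernel_incl_inj; rewrite hE /= cone_diff2 !linear0.
have [|k kE] := exF j (g \- (kernel_incl \o r)).
  move=> p; rewrite -[LHS]/(g (cone_diff p) - kernel_incl (r (cone_diff p))).
  by rewrite -rE hE; apply: subrr.
exists (e \o k) => p; rewrite -[RHS]/(e (k (cone_diff p))) -kE.
rewrite -[X in e X]/(g p - kernel_incl (r p)) linearB gE kernel_inclE.
by rewrite subr0.
Qed.

Lemma finitely_generated_kernel : finitely_generated K.
Proof.
have rowK0 i : e (row i (d 0)) = 0.
  by apply/eker; exists (delta_mx 0 i); rewrite -rowE.
have [w wE] := choice (fun i => kernel_incl_ex (rowK0 i)).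
exists (codom w) => v; have /eker[c cE] := kernel_inclE v.
have sz : size (codom w) = n 1 by rewrite size_codom card_ord.
exists (fun i => if insub i is Some j then c 0 j else 0).
apply: kernel_incl_inj; rewrite cE mulmx_sum_row sz linear_sum.
apply: eq_bigr => i _; rewrite linearZ_LR valK -wE.
by rewrite (nth_map i) ?size_enum_ord // nth_ord_enum.
Qed.

Theorem self_ext_implication_quotient : SACC R -> self_ext_implication M.
Proof.
move=> saccR MS [N0 MN0] i i_gt0.
have coneR j : cone_exact_at R^o j.
  by apply: cone_exact_ring; apply/reduced_exactP/MS.
have coneF j : cone_exact_at 'rV[R]_(n 0) j by apply: cone_exact_rows.
have redM j : (N0 <= j)%N -> reduced_exact M j.
  by move=> le_j; apply/reduced_exactP/MN0/leqW.
have coneM j : cone_exact_at (restrict phi M) j.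
  apply/cone_exact_kernel => //; apply/cone_exact_atP.
  apply: (saccR K) => //.
  - exact: finitely_generated_kernel.
  - by exists (n 0); apply: (kernel_constant_rank regx); apply: restrict_kills.
  - by case=> // k _; apply/cone_exact_atP.
  exists N0.+2 => -[|[|k]] // le_k.
  apply/cone_exact_atP/cone_exact_kernel => //.
  by apply: cone_exact_module; apply: redM; [exact: le_k|exact: leqW le_k].
case: i i_gt0 => // j _; apply/reduced_exactP.
have {redM} : reduced_exact M (j + N0.*2).
  by apply: redM; rewrite -addnn addnA leq_addl.
elim: N0 {MN0} => [|k IHk]; first by rewrite addn0.
rewrite doubleS !addnS => /reduced_exact_descent red.
by apply/IHk/red.
Qed.

End Cohomology.

Theorem theorem1p2 (R : comNzRingType) (m : set R)
  (noethR : noetherian R) (localR : local_ring m) (depthR : positive_depth m)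
  (x : R) (mx : m x) (regx : GRing.lreg x) :
  SACC R -> SAC (quotient_by (local_nonunit localR mx)).
Proof.
move=> saccR M fgM; set S := quotient_by _ in M fgM *.
pose phi : {rmorphism R -> S} := \pi_S.
have phi_surj b : exists a, phi a = b by exists (repr b); apply: reprK.
have phi_ker a : phi a = 0 <-> exists b, a = x * b.
  rewrite -[X in _ = X](rmorph0 phi).
  have piE := Quotient.idealrBE
    (Idealr.clone R (principal_ideal (local_nonunit localR mx)) _) a 0.
  rewrite subr0 in piE.
  split=> [/eqP phi_a|[b ab]].
    have /asboolP[b ab] : a \in principal_ideal (local_nonunit localR mx).
      by rewrite piE.
    by exists b; rewrite mulrC.
  apply/eqP; rewrite -[_ == _]piE; apply/asboolP.
  by exists b; rewrite ab mulrC.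
have [n [e [d [t [esurj eker dker dd]]]]] :=
  lifted_free_resolution x phi_surj noethR fgM.
exact (self_ext_implication_quotient
  phi_surj phi_ker regx esurj eker dker dd saccR).
Qed.
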